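(* Let $f_1,\dots,f_n:\mathbb{R}^d\to\mathbb{R}$ be differentiable and convex, and let $f=\frac1n\sum_{i=1}^n f_i$. Suppose that $f$ and $f_1,\dots,f_n$ are all $L$-smooth and that $f$ has a minimizer $x_\ast\in\mathbb{R}^d$. Let $\sigma_\ast^2=\frac1n\sum_{i=1}^n\|\nabla f_i(x_\ast)\|^2$. Then for Random Reshuffling or Shuffle-Once run for $T\ge1$ epochs from $x_0\in\mathbb{R}^d$ with a stepsize $0<\gamma\le\frac{1}{\sqrt2\,Ln}$, the average iterate $\hat x_T=\frac1T\sum_{j=1}^T x_j$ satisfies $$\mathbb{E}\left[f(\hat x_T)-f(x_\ast)\right]\le\frac{\|x_0-x_\ast\|^2}{2\gamma nT}+\frac{\gamma^2Ln\sigma_\ast^2}{4}.$$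
   Context: $L$-smooth means that the gradient is $L$-Lipschitz. Algorithms. Both algorithms take a stepsize $\gamma>0$, a starting point $x_0\in\mathbb{R}^d$ and a number of epochs $T$. Random Reshuffling (RR): in each epoch $t=0,1,\dots,T-1$, sample afresh (independently) a uniformly random permutation $\pi=(\pi_0,\pi_1,\dots,\pi_{n-1})$ of $\{1,\dots,n\}$, set $x_t^0=x_t$, perform $x_t^{i+1}=x_t^i-\gamma\nabla f_{\pi_i}(x_t^i)$ for $i=0,1,\dots,n-1$, and set $x_{t+1}=x_t^n$. Shuffle-Once (SO): identical, except that a single uniformly random permutation $\pi$ is sampled once before the first epoch and is used in all epochs. The expectation is over the random permutations. *)

(* Defs.v *)
(* MathComp-Analysis *)
From HB Require Import structures.
From mathcomp Require Import all_boot all_order all_algebra all_fingroup.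
From mathcomp Require Import all_classical all_reals all_analysis.

Set Implicit Arguments.
Unset Strict Implicit.
Unset Printing Implicit Defensive.

Import Order.TTheory GRing.Theory Num.Theory.
Import numFieldNormedType.Exports.

Local Open Scope classical_set_scope.
Local Open Scope ring_scope.

(* The norm that MathComp-Analysis puts on row vectors is the sup norm, hence
   the need for a separate Euclidean norm. The two induce the same topology, so
   the library's [differentiable] and ['D_v f x] are the usual notions. *)
Definition enorm (R : realType) (d : nat) (x : 'rV[R]_d) : R :=
  Num.sqrt (\sum_i x ord0 i ^+ 2).

Definition gradient (R : realType) (d : nat) (f : 'rV[R]_d -> R)
    (x : 'rV[R]_d) : 'rV[R]_d :=
  \row_j 'D_(delta_mx ord0 j : 'rV[R]_d) f x.

Definition smooth (R : realType) (d : nat) (L : R) (f : 'rV[R]_d -> R) : Prop :=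
  forall x y, enorm (gradient f x - gradient f y) <= L * enorm (x - y).

Definition average (R : realType) (d n : nat) (f : 'I_n -> 'rV[R]_d -> R)
    (x : 'rV[R]_d) : R :=
  n%:R^-1 * \sum_i f i x.

(* [enum 'I_n] is the list 0, 1, ..., n - 1 in this order. *)
Definition epoch (R : realType) (d n : nat) (gamma : R)
    (f : 'I_n -> 'rV[R]_d -> R) (p : {perm 'I_n}) (x : 'rV[R]_d) : 'rV[R]_d :=
  foldl (fun y i => y - gamma *: gradient (f (p i)) y) x (enum 'I_n).

Fixpoint iterate (R : realType) (d n : nat) (gamma : R)
    (f : 'I_n -> 'rV[R]_d -> R) (x0 : 'rV[R]_d) (p : nat -> {perm 'I_n})
    (t : nat) : 'rV[R]_d :=
  if t is t'.+1 then epoch gamma f (p t') (iterate gamma f x0 p t') else x0.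

(* The average runs over x_1, ..., x_T; the starting point is excluded. *)
Definition average_iterate (R : realType) (d n : nat) (gamma : R)
    (f : 'I_n -> 'rV[R]_d -> R) (x0 : 'rV[R]_d) (p : nat -> {perm 'I_n})
    (T : nat) : 'rV[R]_d :=
  T%:R^-1 *: \sum_(1 <= j < T.+1) iterate gamma f x0 p j.

(* As F is finite, measurability of the preimages of points is measurability
   with respect to the discrete sigma-algebra on F. *)
Definition uniformly_distributed (disp : measure_display)
    (Omega : measurableType disp) (R : realType) (P : probability Omega R)
    (F : finType) (X : Omega -> F) : Prop :=
  forall a : F, measurable (X @^-1` [set a]) /\
    P (X @^-1` [set a]) = (#|F|%:R^-1)%:E.

Definition mutually_independent (disp : measure_display)
    (Omega : measurableType disp) (R : realType) (P : probability Omega R)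
    (I F : finType) (X : I -> Omega -> F) : Prop :=
  forall (J : {set I}) (A : I -> set F),
    P (\bigcap_(i in [set` J]) (X i @^-1` A i)) =
    (\prod_(i in J) P (X i @^-1` A i))%E.

(* In both schemes [p t] is the permutation used in epoch t; only the epochs
   t < T are constrained. *)
Definition random_reshuffling (disp : measure_display)
    (Omega : measurableType disp) (R : realType) (P : probability Omega R)
    (n T : nat) (p : nat -> Omega -> {perm 'I_n}) : Prop :=
  (forall t, (t < T)%N -> uniformly_distributed P (p t)) /\
  mutually_independent P (fun t : 'I_T => p t).

Definition shuffle_once (disp : measure_display)
    (Omega : measurableType disp) (R : realType) (P : probability Omega R)
    (n T : nat) (p : nat -> Omega -> {perm 'I_n}) : Prop :=
  exists q : Omega -> {perm 'I_n}, uniformly_distributed P q /\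
    forall t, (t < T)%N -> p t = q.

(* Main.v *)
(* Write D_f(y, x) for the Bregman divergence of f. Expanding |x - xstar|^2 around
   the end point x' of an epoch with permutation p and inner iterates x^i gives
     2 gamma n (f x' - f xstar) <= |x - xstar|^2 - |x' - xstar|^2
       - 2 gamma sum_i D_{f_{p i}}(xstar, x^i) + gamma L sum_k |x^k - x'|^2.
   By co-coercivity the last sum is at most
     4 gamma^2 n^2 L sum_i D_{f_{p i}}(xstar, x^i)
       + 2 gamma^2 sum_k |sum_{i >= k} grad f_{p i}(xstar)|^2,
   and the stepsize bound lets the Bregman terms cancel. What remains of the noise
   depends on p alone, not on x, so its expectation involves only the uniform law
   of the permutation of the current epoch: this treats both sampling schemes at
   once, and independence between epochs plays no role. It is evaluated by the
   variance formula for sampling without replacement; Jensen's inequality handles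
   the average iterate. *)
Require Import Defs.
From HB Require Import structures.
From mathcomp Require Import all_boot all_order all_algebra all_fingroup.
From mathcomp Require Import all_classical all_reals all_analysis.
From mathcomp Require Import measurable_realfun ring lra.

Set Implicit Arguments.
Unset Strict Implicit.
Unset Printing Implicit Defensive.

Import Order.TTheory GRing.Theory Num.Theory.
Import numFieldNormedType.Exports.

Local Open Scope classical_set_scope.
Local Open Scope ring_scope.

(** * The Euclidean inner product and inequalities for squared norms *)

Definition dot (R : realType) (d : nat) (u v : 'rV[R]_d) : R :=
  \sum_i u ord0 i * v ord0 i.

Section Dot.
Variables (R : realType) (d : nat).
Implicit Types u v w : 'rV[R]_d.

Lemma dotC u v : dot u v = dot v u.
Proof. by apply: eq_bigr => i _; rewrite mulrC. Qed.

Lemma dotDl u v w : dot (u + v) w = dot u w + dot v w.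
Proof. by rewrite -big_split; apply: eq_bigr => i _; rewrite mxE mulrDl. Qed.

Lemma dotNl u v : dot (- u) v = - dot u v.
Proof. by rewrite -sumrN; apply: eq_bigr => i _; rewrite mxE mulNr. Qed.

Lemma dotZl a u v : dot (a *: u) v = a * dot u v.
Proof. by rewrite mulr_sumr; apply: eq_bigr => i _; rewrite mxE mulrA. Qed.

Lemma dotDr u v w : dot w (u + v) = dot w u + dot w v.
Proof. by rewrite dotC dotDl !(dotC w). Qed.

Lemma dotNr u v : dot u (- v) = - dot u v.
Proof. by rewrite dotC dotNl dotC. Qed.

Lemma dotZr a u v : dot u (a *: v) = a * dot u v.
Proof. by rewrite dotC dotZl dotC. Qed.

Lemma dot0l v : dot 0 v = 0.
Proof. by rewrite /dot big1 // => i _; rewrite mxE mul0r. Qed.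

Lemma dot_suml (I : Type) (r : seq I) (Q : pred I) (F : I -> 'rV[R]_d) v :
  dot (\sum_(i <- r | Q i) F i) v = \sum_(i <- r | Q i) dot (F i) v.
Proof.
apply: (big_rec2 (fun a b => dot a v = b)) => [|i a b _ <-].
  exact: dot0l.
exact: dotDl.
Qed.

Lemma dot_sumr (I : Type) (r : seq I) (Q : pred I) (F : I -> 'rV[R]_d) v :
  dot v (\sum_(i <- r | Q i) F i) = \sum_(i <- r | Q i) dot v (F i).
Proof. by rewrite dotC dot_suml; under eq_bigr do rewrite dotC. Qed.

Definition dotE := (dotDl, dotNl, dotZl, dotDr, dotNr, dotZr).

Lemma dot_ge0 u : 0 <= dot u u.
Proof. by apply: sumr_ge0 => i _; rewrite -expr2 sqr_ge0. Qed.

Lemma dot_eq0 u : (dot u u == 0) = (u == 0).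
Proof.
apply/eqP/eqP => [/psumr_eq0P u0|->]; last exact: dot0l.
apply/rowP => i; rewrite mxE; apply/eqP; rewrite -sqrf_eq0 expr2 u0 // => j _.
by rewrite -expr2 sqr_ge0.
Qed.

Lemma dotB_sqr u v : dot (u - v) (u - v) = dot u u - 2 * dot u v + dot v v.
Proof. by rewrite !dotE (dotC v u); ring. Qed.

Lemma dot_le_half u v : 2 * dot u v <= dot u u + dot v v.
Proof. by have := dot_ge0 (u - v); rewrite dotB_sqr; lra. Qed.

Lemma dotD_sqr_le u v :
  dot (u + v) (u + v) <= 2 * dot u u + 2 * dot v v.
Proof. by have := dot_le_half u v; rewrite !dotE (dotC v u); lra. Qed.

Lemma dotD_sqr_ge u v : dot v v + 2 * dot u v <= dot (u + v) (u + v).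
Proof. by have := dot_ge0 u; rewrite !dotE (dotC v u); lra. Qed.

(** Cauchy-Schwarz, by applying [dot_le_half] to each cross term of the expanded square. *)
Lemma dot_sum_sqr_le (n : nat) (u : 'I_n -> 'rV[R]_d) :
  dot (\sum_i u i) (\sum_i u i) <= n%:R * \sum_i dot (u i) (u i).
Proof.
rewrite -(ler_pM2l (x := 2)) // dot_suml mulr_sumr.
under eq_bigr do rewrite dot_sumr mulr_sumr.
apply: (le_trans (y := \sum_i \sum_j (dot (u i) (u i) + dot (u j) (u j)))).
  by apply: ler_sum => i _; apply: ler_sum => j _; exact: dot_le_half.
under eq_bigr do rewrite big_split /= sumr_const card_ord.
by rewrite big_split /= sumr_const card_ord sumrMnl -mulr_natl; lra.
Qed.

Lemma enorm_sqr u : enorm u ^+ 2 = dot u u.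
Proof.
rewrite sqr_sqrtr; first by apply: eq_bigr => i _; rewrite expr2.
by apply: sumr_ge0 => i _; exact: sqr_ge0.
Qed.

End Dot.

(** * Gradients, Bregman divergences and smoothness *)

Section Gradient.
Variables (R : realType) (d : nat).
Implicit Types (f : 'rV[R]_d -> R) (u v x y : 'rV[R]_d).

Lemma derive_dot_gradient f x v :
  differentiable f x -> 'D_v f x = dot (gradient f x) v.
Proof.
move=> df; rewrite deriveE // {1}(row_sum_delta v) linear_sum.
apply: eq_bigr => j _; rewrite linearZ /= -deriveE // mxE.
by rewrite mulrC.
Qed.

(** The difference quotient at [t] along the line is the directional one of [f] at [x + t *: v]. *)
Lemma is_derive_line f x v (t : R) :
  differentiable f (x + t *: v) ->
  is_derive t 1 (fun s : R => f (x + s *: v))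
    (dot (gradient f (x + t *: v)) v).
Proof.
move=> df; rewrite -derive_dot_gradient //.
have quotE : (fun h : R => h^-1 *:
      (((fun s : R => f (x + s *: v)) \o shift t) (h *: (1 : R)) -
       f (x + t *: v))) =
    (fun h : R => h^-1 *:
      ((f \o shift (x + t *: v)) (h *: v) - f (x + t *: v))).
  apply/funext => h /=; congr (_ *: (f _ - _)).
  by rewrite [h *: 1]mulr1 scalerDl addrCA.
apply: DeriveDef; last by rewrite /derive quotE.
by rewrite /derivable quotE; exact: diff_derivable.
Qed.

Definition bregman f y x := f y - f x - dot (gradient f x) (y - x).

(** For steps [0 < h <= 1] convexity bounds the difference quotient along [y - x] by [f y - f x];
    hence the passage to the right-hand limit at 0. *)
Lemma bregman_ge0 f x y : differentiable f x ->
  convex_function [set: 'rV[R]_d] f -> 0 <= bregman f y x.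
Proof.
move=> df cf; rewrite /bregman subr_ge0 -derive_dot_gradient //.
have dv : derivable f x (y - x) by exact: diff_derivable.
rewrite /derive cvg_at_rightE //; apply: limr_le.
  by apply: cvgP; apply: cvg_dnbhs_at_right; exact: dv.
near=> h.
have h0 : 0 < h by [].
have h1 : h <= 1 by near: h; apply: nbhs_right_le.
have := cf (Itv01 (ltW h0) h1) y x (in_setT _) (in_setT _).
have -> : conv (Itv01 (ltW h0) h1) (y : convex_lmodType 'rV[R]_d) x
    = h *: (y - x) + x.
  rewrite -[LHS]/(h *: y + (1 - h) *: x) scalerBr scalerBl scale1r.
  by rewrite addrA addrAC.
rewrite -[leRHS]/(h * f y + (1 - h) * f x) => ch.
rewrite -[leLHS]/(h^-1 * (f (h *: (y - x) + x) - f x)) mulrC ler_pdivrMr //.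
by move: ch; lra.
Unshelve. all: by end_near. Qed.

Lemma smooth_sqr L f x y : smooth L f ->
  dot (gradient f x - gradient f y) (gradient f x - gradient f y) <=
  L ^+ 2 * dot (x - y) (x - y).
Proof.
move=> /(_ x y) sf; rewrite -!enorm_sqr -exprMn ler_sqr // nnegrE.
  exact: sqrtr_ge0.
by apply: le_trans sf; exact: sqrtr_ge0.
Qed.

Lemma bregman_le L f x y : 0 < L -> (forall z, differentiable f z) ->
  smooth L f -> bregman f y x <= L / 2 * dot (y - x) (y - x).
Proof.
move=> L0 df sf; rewrite /bregman; set v := y - x.
(* psi is nonincreasing: its derivative dpsi is nonpositive by Young's inequality
   in the form 0 <= |g - L c v|^2, where g is the increment of the gradient. *)
pose phi (s : R) := f (x + s *: v).
pose psi (s : R) := phi s - s * dot (gradient f x) v - L / 2 * s ^+ 2 * dot v v.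
pose dpsi (s : R) :=
  dot (gradient f (x + s *: v)) v - dot (gradient f x) v - L * s * dot v v.
have dpsiP (s : R) : is_derive s 1 psi (dpsi s).
  have phi' := is_derive_line (df (x + s *: v)).
  rewrite /psi /phi; apply: is_derive_eq.
  by rewrite /dpsi !scaler0 /GRing.scale /=; lra.
have [|c] := @MVT R psi dpsi 0 1 ltr01 (fun s _ => dpsiP s).
  apply: continuous_subspaceT => s; apply: differentiable_continuous.
  by apply/derivable1_diffP.
rewrite in_itv /= => /andP[c0 c1].
rewrite subr0 mulr1 /psi /phi scale1r scale0r addr0 /v subrKC -/v.
suff : dpsi c <= 0 by lra.
have Lc : 0 < L * c by rewrite mulr_gt0.
have := smooth_sqr (x + c *: v) x sf.
rewrite /dpsi -dotNl -dotDl [x + _ - x]addrAC subrr add0r.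
move: (gradient f _ - gradient f x) => g; rewrite dotZl dotZr => hg.
have := dot_ge0 (g - (L * c) *: v).
rewrite dotB_sqr dotZl !dotZr => g0.
by rewrite -(ler_pM2l Lc) mulr0; lra.
Qed.

Lemma sqr_gradient_le_bregman L f x y : 0 < L ->
  (forall z, differentiable f z) -> convex_function [set: 'rV[R]_d] f ->
  smooth L f ->
  dot (gradient f x - gradient f y) (gradient f x - gradient f y) <=
  2 * L * bregman f y x.
Proof.
move=> L0 df cf sf; set g := gradient f x - gradient f y.
(* z minimizes over w the quadratic upper bound of f w - <gradient f x, w>
   at y, and this function is smallest at w = x. *)
pose z := y + L^-1 *: g.
have := bregman_ge0 z (df x) cf.
have := bregman_le y z L0 df sf.
rewrite /bregman.
have -> : z - x = (y - x) + L^-1 *: g by rewrite /z addrAC.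
have -> : z - y = L^-1 *: g by rewrite /z addrC addKr.
have : dot (gradient f x) g = dot g g + dot (gradient f y) g.
  by rewrite -dotDl subrK.
rewrite dotDr !dotZr dotZl; move: (dot g g) => G -> descent ge0.
have Ln0 : L != 0 by rewrite gt_eqF.
have GE : L / 2 * (L^-1 * (L^-1 * G)) = L^-1 * G / 2 by field.
rewrite -mulrA mulrCA -ler_pdivrMl // mulrC; move: descent ge0.
by rewrite GE; lra.
Qed.

End Gradient.

(** * Finite averages and first-order optimality *)

Section Average.
Variables (R : realType) (d n : nat) (f : 'I_n -> 'rV[R]_d -> R).
Hypothesis df : forall i x, differentiable (f i) x.
Implicit Types x y : 'rV[R]_d.

Lemma averageE : average f = n%:R^-1 *: (\sum_i f i).
Proof. by apply/funext => x; rewrite /average fct_sumE. Qed.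

Lemma differentiable_average x : differentiable (average f) x.
Proof. by rewrite averageE; apply/differentiableZ/differentiable_sum. Qed.

Lemma gradient_average x :
  gradient (average f) x = n%:R^-1 *: \sum_i gradient (f i) x.
Proof.
apply/rowP => j; rewrite !mxE summxE averageE.
rewrite deriveZ; last by apply: derivable_sum => i; exact: diff_derivable.
rewrite derive_sum; last by move=> i; exact: diff_derivable.
by congr (_ *: _); apply: eq_bigr => i _; rewrite mxE.
Qed.

(** The divergence is linear in the function, so its nonnegativity passes from the components to the
    average. *)
Lemma bregman_average y x :
  bregman (average f) y x = n%:R^-1 * \sum_i bregman (f i) y x.
Proof.
rewrite /bregman gradient_average dotZl dot_suml /average -!mulrBr.
by congr (_ * _); rewrite !sumrB.
Qed.

End Average.

Section Minimizer.
Variables (R : realType) (d : nat) (L : R) (f : 'rV[R]_d -> R) (x : 'rV[R]_d).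
Hypotheses (L0 : 0 < L) (df : forall y, differentiable f y) (sf : smooth L f).

(** A gradient step of size [L^-1] lowers [f] by at least [dot g g / (2 * L)], which at a minimizer
    forces [g = 0]. *)
Lemma gradient_minimizer : (forall y, f x <= f y) -> gradient f x = 0.
Proof.
set g := gradient f x => minf; apply/eqP; rewrite -dot_eq0.
have := bregman_le x (x - L^-1 *: g) L0 df sf; rewrite /bregman -/g.
have -> : x - L^-1 *: g - x = - (L^-1 *: g) by rewrite addrAC subrr add0r.
rewrite dotNl !dotNr dotZl !dotZr opprK => h.
have := minf (x - L^-1 *: g); rewrite -subr_ge0 => f0.
have Ln0 : L != 0 by rewrite gt_eqF.
have hE : L / 2 * (L^-1 * (L^-1 * dot g g)) = L^-1 * dot g g / 2 by field.
rewrite eq_le dot_ge0 andbT -(pmulr_rle0 _ (x := L^-1)) ?invr_gt0 //.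
by move: h; rewrite opprK hE; lra.
Qed.

End Minimizer.

(** * Descent over one epoch *)

Definition tail_sum (R : realType) (d n : nat) (a : 'I_n -> 'rV[R]_d)
    (p : {perm 'I_n}) (k : nat) : 'rV[R]_d :=
  \sum_(i < n | (k <= i)%N) a (p i).

(** With [a] the gradients at [xstar], this is the noise left by one epoch. Tails occur, not
    prefixes, because drift is measured from the end point of the epoch. *)
Definition tail_variance (R : realType) (d n : nat) (a : 'I_n -> 'rV[R]_d)
    (p : {perm 'I_n}) : R :=
  \sum_(k < n) dot (tail_sum a p k) (tail_sum a p k).

Section Epoch.
Variables (R : realType) (d n : nat) (f : 'I_n -> 'rV[R]_d -> R).
Variables (L gamma : R) (xstar : 'rV[R]_d).
Hypotheses (n0 : (0 < n)%N) (L0 : 0 < L) (gamma0 : 0 < gamma).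
Hypothesis df : forall i x, differentiable (f i) x.
Hypothesis cf : forall i, convex_function [set: 'rV[R]_d] (f i).
Hypothesis sf : forall i, smooth L (f i).
Hypothesis gamma_le : 2 * (L * n%:R * gamma) ^+ 2 <= 1.

Section Inner.
Variables (p : {perm 'I_n}) (z : nat -> 'rV[R]_d).
Hypothesis zS :
  forall i : 'I_n, z i.+1 = z i - gamma *: gradient (f (p i)) (z i).

Let G (i : 'I_n) := gradient (f (p i)) (z i).
Let D (i : 'I_n) := bregman (f (p i)) xstar (z i).
Let a (i : 'I_n) := gradient (f i) xstar.

Lemma tail_step k : (k <= n)%N ->
  z k - z n = gamma *: \sum_(i < n | (k <= i)%N) G i.
Proof.
move=> kn; rewrite -opprB -telescope_sumr // big_geq_mkord /=.
rewrite scaler_sumr -sumrN.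
by apply: eq_bigr => i _; rewrite zS addrAC subrr add0r opprK.
Qed.

(** Each gradient splits into the one at [xstar], which yields the tail sum, and a deviation
    controlled by co-coercivity. *)
Lemma tail_gradient_le (k : nat) :
  dot (\sum_(i < n | (k <= i)%N) G i) (\sum_(i < n | (k <= i)%N) G i) <=
  4 * n%:R * L * (\sum_i D i) + 2 * dot (tail_sum a p k) (tail_sum a p k).
Proof.
(* Zero padding lets Cauchy-Schwarz run over all [n] indices; a padded term is bounded by the
   nonnegative [2 * L * D i]. *)
pose u (i : 'I_n) := if (k <= i)%N then G i - a (p i) else 0.
have -> : \sum_(i < n | (k <= i)%N) G i = \sum_i u i + tail_sum a p k.
  rewrite /u -big_mkcond /tail_sum -big_split /=.
  by under [RHS]eq_bigr do rewrite subrK.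
apply: le_trans (dotD_sqr_le _ _) _; rewrite lerD2r.
rewrite (_ : 4 * n%:R * L * _ = 2 * (n%:R * (2 * L * \sum_i D i)));
  last by ring.
rewrite ler_pM2l //; apply: le_trans (dot_sum_sqr_le u) _.
rewrite ler_wpM2l // mulr_sumr; apply: ler_sum => i _.
have gB : dot (G i - a (p i)) (G i - a (p i)) <= 2 * L * D i.
  exact: sqr_gradient_le_bregman.
rewrite /u; case: ifP => // _; rewrite dot0l; exact: le_trans (dot_ge0 _) gB.
Qed.

Lemma inner_descent :
  2 * gamma * n%:R * (average f (z n) - average f xstar) <=
  dot (z 0 - xstar) (z 0 - xstar) - dot (z n - xstar) (z n - xstar) +
  2 * gamma ^+ 3 * L * tail_variance a p.
Proof.
have nR : n%:R != 0 :> R by rewrite pnatr_eq0 -lt0n.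
have avE x : n%:R * average f x = \sum_i f (p i) x.
  by rewrite /average mulrA mulfV // mul1r (reindex_inj (@perm_inj _ p)).
have z0E : z 0 - z n = gamma *: \sum_i G i.
  by rewrite tail_step.
have D0 : 0 <= \sum_i D i by apply: sumr_ge0 => i _; exact: bregman_ge0.
(* Three-point identity for the divergences at [xstar], [z n] and [z i], summed over [i]. *)
have hG : \sum_i dot (G i) (z n - xstar) =
    n%:R * (average f (z n) - average f xstar) + \sum_i D i -
    \sum_i bregman (f (p i)) (z n) (z i).
  rewrite mulrBr !avE -!sumrB -big_split -sumrB /=; apply: eq_bigr => i _.
  by rewrite /D /bregman -/(G i) !dotE; ring.
(* Smoothness reduces the divergences to the drift. One factor [n] comes from Cauchy-Schwarz, the
   other from summing over [k]. *)
have hB : \sum_i bregman (f (p i)) (z n) (z i) <= L / 2 *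
    (gamma ^+ 2 * (4 * n%:R ^+ 2 * L * (\sum_i D i) + 2 * tail_variance a p)).
  apply: (le_trans (y := \sum_(i < n) (L / 2) * dot (z n - z i) (z n - z i))).
    by apply: ler_sum => i _; exact: bregman_le.
  rewrite -mulr_sumr ler_wpM2l ?divr_ge0 ?(ltW L0) //.
  apply: (le_trans (y := \sum_(k < n) gamma ^+ 2 *
      (4 * n%:R * L * (\sum_i D i) +
       2 * dot (tail_sum a p k) (tail_sum a p k)))).
    apply: ler_sum => k _.
    rewrite -opprB dotNl dotNr opprK tail_step ?(ltnW (ltn_ord k)) //.
    rewrite dotZl dotZr mulrA -expr2 ler_wpM2l ?sqr_ge0 //.
    exact: tail_gradient_le.
  rewrite -mulr_sumr big_split /= sumr_const card_ord -mulr_sumr.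
  by rewrite -[_ *+ n]mulr_natl /tail_variance; lra.
(* Expansion around the end point; the square of [z 0 - z n] is dropped. *)
have := dotD_sqr_ge (z 0 - z n) (z n - xstar).
rewrite addrA subrK z0E dotZl dot_suml hG => hz.
(* The stepsize bound makes the divergences produced by the drift at most those gained in [hG]. *)
have hD : gamma * (gamma ^+ 2 * (2 * n%:R ^+ 2 * L ^+ 2)) * (\sum_i D i) <=
    gamma * \sum_i D i.
  rewrite ler_wpM2r // -[leRHS]mulr1 ler_wpM2l ?(ltW gamma0) //.
  by move: gamma_le; lra.
rewrite -(ler_pM2l gamma0) in hB.
by move: hz hD hB; lra.
Qed.

End Inner.

Lemma epoch_descent (p : {perm 'I_n}) (x : 'rV[R]_d) :
  2 * gamma * n%:R * (average f (epoch gamma f p x) - average f xstar) <=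
  dot (x - xstar) (x - xstar) -
  dot (epoch gamma f p x - xstar) (epoch gamma f p x - xstar) +
  2 * gamma ^+ 3 * L * tail_variance (fun i => gradient (f i) xstar) p.
Proof.
(* Inner iterates as folds over prefixes, so that [z 0] is [x] and [z n] the result of the epoch. *)
pose z k := foldl (fun y i => y - gamma *: gradient (f (p i)) y) x
  (take k (enum 'I_n)).
have zS (i : 'I_n) : z i.+1 = z i - gamma *: gradient (f (p i)) (z i).
  rewrite /z (take_nth i) ?size_enum_ord ?ltn_ord // foldl_rcons.
  by rewrite nth_ord_enum.
have := inner_descent zS.
by rewrite /z take0 take_oversize ?size_enum_ord.
Qed.

End Epoch.

(** * Sampling without replacement *)

Lemma sum_mul_codistance (R : realType) (n : nat) :
  6 * \sum_(k < n) k%:R * (n%:R - k%:R) = (n%:R - 1) * n%:R * (n%:R + 1) :> R.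
Proof.
(* Induction needs the [n] inside the summand decoupled from the range of summation. *)
suff gen (c : R) : 6 * \sum_(k < n) k%:R * (c - k%:R) =
    n%:R * (n%:R - 1) * (3 * c - 2 * n%:R + 1).
  by rewrite gen; ring.
elim: n => [|n IH]; first by rewrite big_ord0; ring.
by rewrite big_ord_recr /= mulrDr IH -natr1; ring.
Qed.

Lemma sum_tail_const (V : zmodType) (n k : nat) (c : V) :
  \sum_(i < n | (k <= i)%N) c = c *+ (n - k).
Proof. by rewrite -(big_geq_mkord _ _ predT (fun=> c)) sumr_const_nat. Qed.

Section WithoutReplacement.
Variables (R : realType) (d n : nat) (a : 'I_n -> 'rV[R]_d).
Hypothesis a_sum0 : \sum_i a i = 0.

(** Second moments without normalization: [Q i j] is [N] times the mean of [dot (a (p i)) (a (p j))]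
    over uniform [p]. *)
Let Q (i j : 'I_n) : R := \sum_(p : {perm 'I_n}) dot (a (p i)) (a (p j)).
Let N : R := #|{perm 'I_n}|%:R.
Let S : R := \sum_i dot (a i) (a i).

Lemma perm_sum0 (p : {perm 'I_n}) : \sum_i a (p i) = 0.
Proof. by rewrite -[RHS]a_sum0 [RHS](reindex_inj (@perm_inj _ p)). Qed.

(** Left translation by [s] is a bijection of the symmetric group. Hence [Q i j] depends only on
    whether [i = j]. *)
Lemma moment_perm (s : {perm 'I_n}) i j : Q (s i) (s j) = Q i j.
Proof.
rewrite /Q [RHS](reindex_inj (mulgI s)).
by apply: eq_bigr => p _; rewrite !permM.
Qed.

(** The diagonal entries are equal, and each permutation contributes [S] to their sum. *)
Lemma moment_diag i : n%:R * Q i i = N * S.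
Proof.
transitivity (\sum_(j < n) Q j j).
  rewrite (eq_bigr (fun=> Q i i)) ?sumr_const ?card_ord ?mulr_natl // => j _.
  by rewrite -[in LHS](tpermL i j) moment_perm.
have pS (p : {perm 'I_n}) : \sum_i dot (a (p i)) (a (p i)) = S.
  by rewrite /S [RHS](reindex_inj (@perm_inj _ p)).
rewrite /Q exchange_big; under eq_bigr do rewrite pS.
by rewrite sumr_const /N mulr_natl.
Qed.

Lemma moment_row_sum0 i : \sum_j Q i j = 0.
Proof.
rewrite /Q exchange_big big1 // => p _.
by rewrite -dot_sumr perm_sum0 dotC dot0l.
Qed.

(** The [n - 1] off-diagonal entries of a row are equal, and the row sums to zero because [a]
    does. *)
Lemma moment_offdiag i j : i != j -> (n%:R - 1) * Q i j = - Q i i.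
Proof.
move=> ij; have := moment_row_sum0 i; rewrite (bigD1 i) //=.
rewrite (eq_bigr (fun=> Q i j)) => [|k ki].
  rewrite sumr_const cardC1 card_ord => /eqP.
  rewrite addr_eq0 => /eqP ->; rewrite opprK -[RHS]mulr_natl.
  congr (_ * _); rewrite -subn1 natrB //.
  exact: leq_ltn_trans (leq0n i) (ltn_ord i).
by rewrite -[RHS](moment_perm (tperm j k)) tpermL tpermD // eq_sym.
Qed.

Lemma moment_eq i j :
  n%:R * ((n%:R - 1) * Q i j) = N * S * (n%:R * (i == j)%:R - 1).
Proof.
have [<-|ij] := eqVneq i j; first by rewrite mulrCA moment_diag mulr1 mulrC.
by rewrite moment_offdiag // mulrN moment_diag mulr0; ring.
Qed.

(** Variance formula, cleared of denominators: each of the [n - k] rows has [n - k] entries, one of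
    them diagonal, and contributes [n - (n - k) = k]. *)
Lemma moment_tail_sum (k : nat) : (k <= n)%N ->
  n%:R * ((n%:R - 1) * \sum_p dot (tail_sum a p k) (tail_sum a p k)) =
  N * S * (k%:R * (n%:R - k%:R)).
Proof.
(* S is made opaque so that mulr_sumr does not see through it. *)
move=> kn; have QE := moment_eq; clearbody S.
have -> : \sum_p dot (tail_sum a p k) (tail_sum a p k) =
    \sum_(i < n | (k <= i)%N) \sum_(j < n | (k <= j)%N) Q i j.
  rewrite /Q; under [RHS]eq_bigr do rewrite exchange_big.
  rewrite [RHS]exchange_big; apply: eq_bigr => p _.
  by rewrite /tail_sum dot_suml; under [LHS]eq_bigr do rewrite dot_sumr.
have row (i : 'I_n) : (k <= i)%N ->
    n%:R * ((n%:R - 1) * \sum_(j < n | (k <= j)%N) Q i j) = N * S * k%:R.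
  move=> ki; rewrite !mulr_sumr; under eq_bigr do rewrite QE.
  rewrite -[LHS]mulr_sumr sumrB sum_tail_const natrB // (bigD1 i) //= eqxx /=.
  rewrite big1 => [|j /andP[_ ji]]; last by rewrite eq_sym (negbTE ji) mulr0.
  by ring.
rewrite !mulr_sumr; under eq_bigr => i ki do rewrite row //.
by rewrite sum_tail_const -[LHS]mulr_natr natrB // -!mulrA.
Qed.

(** For [n >= 2] the mean of [tail_variance] is exactly [(n + 1) * S / 6], and
    [2 * (n + 1) <= 3 * n]. *)
Lemma sum_tail_variance_le :
  4 * \sum_p tail_variance a p <= N * n%:R * S.
Proof.
have S0 : 0 <= S by apply: sumr_ge0 => i _; exact: dot_ge0.
(* For [n <= 1] the factor [n - 1] cannot be cancelled, but the only possible tail is the full sum,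
   which vanishes. *)
have [n1|n1] := leqP n 1.
  rewrite big1 ?mulr0 => [|p _]; first by rewrite !mulr_ge0 // ler0n.
  rewrite /tail_variance big1 // => k _.
  rewrite /tail_sum (eq_bigl xpredT) ?perm_sum0 ?dot0l // => i.
  by move: (leq_trans (ltn_ord k) n1); case: (nat_of_ord k).
have tailE := moment_tail_sum; clearbody S.
have nR : 2 <= n%:R :> R by rewrite (ler_nat _ 2).
have : n%:R * ((n%:R - 1) * \sum_p tail_variance a p) =
    N * S * \sum_(k < n) k%:R * (n%:R - k%:R).
  rewrite /tail_variance exchange_big /= !mulr_sumr; apply: eq_bigr => k _.
  exact: tailE (ltnW (ltn_ord k)).
have := sum_mul_codistance R n; move: (\sum_(k < n) _) => C C6 TE.
have NS0 : 0 <= N * S by rewrite mulr_ge0 // ler0n.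
rewrite mulrAC; move: NS0 TE; move: (N * S) (\sum_p _) => NS TV NS0 TE.
have TV6 : 6 * TV = NS * (n%:R + 1).
  have nn0 : n%:R * (n%:R - 1) != 0 :> R.
    by rewrite mulf_neq0 // gt_eqF //; lra.
  apply: (mulfI nn0).
  transitivity (6 * (n%:R * ((n%:R - 1) * TV))); first by ring.
  by rewrite TE mulrCA C6; ring.
have : 0 <= NS * (n%:R - 2) by rewrite mulr_ge0 // subr_ge0.
by move: TV6; lra.
Qed.

End WithoutReplacement.

(** * Pathwise bound for the average iterate *)

Lemma sum_average_iterate (R : realType) (d n : nat) (gamma : R)
    (f : 'I_n -> 'rV[R]_d -> R) (x0 : 'rV[R]_d) (p : nat -> {perm 'I_n})
    (T : nat) : (0 < T)%N ->
  T%:R *: average_iterate gamma f x0 p T =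
  \sum_(t < T) iterate gamma f x0 p t.+1.
Proof.
move=> T0; rewrite /average_iterate scalerA mulfV ?scale1r ?pnatr_eq0 -?lt0n //.
by rewrite big_add1 big_mkord.
Qed.

Section Run.
Variables (R : realType) (d n : nat) (f : 'I_n -> 'rV[R]_d -> R).
Variables (L gamma : R) (xstar : 'rV[R]_d).
Hypotheses (n0 : (0 < n)%N) (L0 : 0 < L) (gamma0 : 0 < gamma).
Hypothesis df : forall i x, differentiable (f i) x.
Hypothesis cf : forall i, convex_function [set: 'rV[R]_d] (f i).
Hypothesis sf : forall i, smooth L (f i).
Hypothesis gamma_le : 2 * (L * n%:R * gamma) ^+ 2 <= 1.

Let a (i : 'I_n) := gradient (f i) xstar.

Lemma run_descent (x0 : 'rV[R]_d) (p : nat -> {perm 'I_n}) (T : nat) :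
  2 * gamma * n%:R *
    (\sum_(t < T) (average f (iterate gamma f x0 p t.+1) - average f xstar)) <=
  dot (x0 - xstar) (x0 - xstar) +
  2 * gamma ^+ 3 * L * \sum_(t < T) tail_variance a (p t).
Proof.
(* The final distance is kept for the telescoping induction and dropped at the end. *)
apply: (le_trans (y := dot (x0 - xstar) (x0 - xstar) -
  dot (iterate gamma f x0 p T - xstar) (iterate gamma f x0 p T - xstar) +
  2 * gamma ^+ 3 * L * \sum_(t < T) tail_variance a (p t))); last first.
  by rewrite lerD2r gerBl dot_ge0.
elim: T => [|T IH]; first by rewrite !big_ord0 !mulr0 subrr addr0.
rewrite !big_ord_recr /= !mulrDr.
have := epoch_descent xstar n0 L0 gamma0 df cf sf gamma_le (p T)
  (iterate gamma f x0 p T).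
by move: IH; rewrite -/a; lra.
Qed.

(** Jensen's inequality: the divergences from [x] to the [y t] are nonnegative, and their linear
    terms cancel in the sum. *)
Lemma average_convex (T : nat) (y : 'I_T -> 'rV[R]_d) x :
  T%:R *: x = \sum_t y t ->
  T%:R * average f x <= \sum_t average f (y t).
Proof.
move=> xE.
have B0 t : 0 <= bregman (average f) (y t) x.
  rewrite bregman_average // mulr_ge0 ?invr_ge0 ?ler0n // sumr_ge0 // => i _.
  exact: bregman_ge0.
have : 0 <= \sum_t bregman (average f) (y t) x by exact: sumr_ge0.
rewrite /bregman !sumrB !sumr_const -dot_sumr sumrB -xE sumr_const card_ord.
by rewrite -[x *+ T]scaler_nat subrr dotC dot0l subr0 subr_ge0 mulr_natl.
Qed.

Lemma average_iterate_le (x0 : 'rV[R]_d) (p : nat -> {perm 'I_n}) (T : nat) :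
  (0 < T)%N ->
  average f (average_iterate gamma f x0 p T) - average f xstar <=
  dot (x0 - xstar) (x0 - xstar) / (2 * gamma * n%:R * T%:R) +
  \sum_(t < T) gamma ^+ 2 * L / (n%:R * T%:R) * tail_variance a (p t).
Proof.
move=> T0.
have nR : 0 < n%:R :> R by rewrite ltr0n.
have TR : 0 < T%:R :> R by rewrite ltr0n.
have c0 : 0 < 2 * gamma * n%:R * T%:R by rewrite !mulr_gt0.
rewrite -[X in _ <= _ + X]mulr_sumr.
have := average_convex (sum_average_iterate gamma f x0 p T0).
have := run_descent x0 p T.
rewrite sumrB sumr_const card_ord -[_ *+ T]mulr_natl.
move: (\sum_(t < T) average f (iterate gamma f x0 p t.+1)) => A.
move: (\sum_(t < T) tail_variance a (p t)) => V.
move: (average f _) (average f _) (dot _ _) => F Fstar D hV hJ.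
rewrite -(ler_pM2l c0).
have -> : 2 * gamma * n%:R * T%:R * (D / (2 * gamma * n%:R * T%:R) +
    gamma ^+ 2 * L / (n%:R * T%:R) * V) = D + 2 * gamma ^+ 3 * L * V.
  by field; rewrite !gt_eqF.
apply: le_trans hV; rewrite -[_ * T%:R * _]mulrA ler_pM2l ?mulr_gt0 //.
by rewrite mulrBr lerD2r.
Qed.

End Run.

(** * Expectations under uniform laws on finite types *)

Section Expectation.
Variables (disp : measure_display) (Omega : measurableType disp).
Variables (R : realType) (P : probability Omega R).

(* Measurability is not needed: the integral of a nonnegative function is the
   supremum of the integrals of the simple functions below it. *)
Lemma ge0_le_expectation (X Y : Omega -> R) :
  (forall w, 0 <= X w) -> (forall w, X w <= Y w) -> ('E_P[X] <= 'E_P[Y])%E.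
Proof.
move=> X0 XY; rewrite unlock !ge0_integralTE => [|w|w]; last 2 first.
- by rewrite lee_fin (le_trans (X0 w)).
- by rewrite lee_fin.
apply: ereal_sup_le => _ [h hX <-]; exists h => // w /=.
by rewrite (le_trans (hX w)) // lee_fin.
Qed.

Section Uniform.
Variables (F : finType) (q : Omega -> F) (h : F -> R).
Hypotheses (q_unif : uniformly_distributed P q) (h0 : forall a, 0 <= h a).

Lemma measurable_uniform (A : set F) : measurable (q @^-1` A).
Proof.
have -> : q @^-1` A = \bigcup_(a in A) q @^-1` [set a].
  apply/seteqP; split=> [w Aw|w [a Aa /= qa]]; last by rewrite /= qa.
  by exists (q w).
by apply: fin_bigcup_measurable => // a _; case: (q_unif a).
Qed.

Lemma measurable_fun_uniform : measurable_fun [set: Omega] (h \o q).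
Proof.
move=> _ Y _; rewrite setTI comp_preimage; exact: measurable_uniform.
Qed.

(** [h \o q] is a combination of indicators of the events [q = a], each of probability
    [#|F|%:R^-1]. *)
Lemma expectation_uniform :
  ('E_P[h \o q] = (#|F|%:R^-1 * \sum_a h a)%:E)%E.
Proof.
rewrite unlock.
have hE w : ((h \o q) w)%:E = (\sum_a (h a)%:E * (\1_(q @^-1` [set a]) w)%:E)%E.
  rewrite sumEFin; congr (_%:E).
  rewrite (bigD1 (q w)) //= big1 ?addr0 => [|a aq].
    by rewrite indicE mem_set // mulr1.
  by rewrite indicE memNset ?mulr0 // => /= qa; rewrite qa eqxx in aq.
under eq_integral do rewrite hE.
rewrite ge0_integral_sum //; last 2 first.
- move=> a; apply: emeasurable_funM => //.
  by apply/measurable_EFinP/measurable_indic; case: (q_unif a).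
- by move=> a w _; rewrite mule_ge0 ?lee_fin.
rewrite mulr_sumr -sumEFin; apply: eq_bigr => a _.
have [mqa Pqa] := q_unif a.
rewrite ge0_integralZl_EFin //; last first.
  by apply/measurable_EFinP; exact: measurable_indic.
by rewrite integral_indic // setIT [X in (_ * X)%E]Pqa -EFinM mulrC.
Qed.

End Uniform.

(** Linearity of the integral for nonnegative functions reduces the claim to the law of each
    [q t]. *)
Lemma expectation_const_add_sum (F : finType) (T : nat) (q : nat -> Omega -> F)
    (h : F -> R) (c : R) :
  (forall t, (t < T)%N -> uniformly_distributed P (q t)) ->
  (forall a, 0 <= h a) -> 0 <= c ->
  ('E_P[fun w => (c + \sum_(t < T) h (q t w))%R] =
   (c + T%:R * (#|F|%:R^-1 * \sum_a h a))%R%:E)%E.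
Proof.
move=> q_unif h0 c0; rewrite unlock.
under eq_integral do rewrite EFinD -sumEFin.
have mh t : (t < T)%N -> measurable_fun [set: Omega] (fun w => (h (q t w))%:E).
  move=> tT; apply/measurable_EFinP.
  exact: measurable_fun_uniform (q_unif t tT).
rewrite ge0_integralD //; last 2 first.
- by move=> w _; apply: sume_ge0 => t _; rewrite lee_fin.
- by apply: emeasurable_sum => t; exact: mh.
rewrite integral_cst // [X in (_ * X)%E]probability_setT mule1.
rewrite ge0_integral_sum //; last 2 first.
- by move=> t; exact: mh.
- by move=> t w _; rewrite lee_fin.
rewrite EFinD; congr (_ + _)%E.
have hE (t : 'I_T) :
    (\int[P]_w (h (q t w))%:E = (#|F|%:R^-1 * \sum_a h a)%:E)%E.
  by rewrite -(expectation_uniform (q_unif t (ltn_ord t)) h0) unlock.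
under eq_bigr do rewrite hE.
by rewrite sumEFin sumr_const card_ord mulr_natl.
Qed.

End Expectation.

(** * The convergence rate in expectation *)

Theorem theorem3 (R : realType) (d n : nat) (f : 'I_n -> 'rV[R]_d -> R)
    (L gamma : R) (x0 xstar : 'rV[R]_d) (T : nat)
    (disp : measure_display) (Omega : measurableType disp)
    (P : probability Omega R) (p : nat -> Omega -> {perm 'I_n})
    (hn : (0 < n)%N) (hL : 0 < L)
    (hdiff : forall i x, differentiable (f i) x)
    (hconv : forall i, convex_function [set: 'rV[R]_d] (f i))
    (hsmooth : smooth L (average f))
    (hsmooths : forall i, smooth L (f i))
    (hmin : forall x, average f xstar <= average f x)
    (hT : (1 <= T)%N)
    (hgamma0 : 0 < gamma)
    (hgamma : gamma <= 1 / (Num.sqrt 2 * L * n%:R))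
    (hp : random_reshuffling P T p \/ shuffle_once P T p) :
  let sigma2 := n%:R^-1 * \sum_i enorm (gradient (f i) xstar) ^+ 2 in
  ('E_P[fun w => (average f (average_iterate gamma f x0 (p ^~ w) T)
                  - average f xstar)%R]
   <= (enorm (x0 - xstar) ^+ 2 / (2 * gamma * n%:R * T%:R)
       + gamma ^+ 2 * L * n%:R * sigma2 / 4)%R%:E)%E.
Proof.
cbv zeta.
have unif t : (t < T)%N -> uniformly_distributed P (p t).
  by move=> tT; case: hp => [[u _]|[q [u pq]]]; [exact: u | rewrite pq].
have nR : 0 < n%:R :> R by rewrite ltr0n.
have TR : 0 < T%:R :> R by rewrite ltr0n.
have gamma_le : 2 * (L * n%:R * gamma) ^+ 2 <= 1.
  have s2 : 0 < Num.sqrt 2 * L * n%:R by rewrite !mulr_gt0 ?sqrtr_gt0.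
  move: hgamma; rewrite ler_pdivlMr // mulrC => g1.
  rewrite -[X in X * _](sqr_sqrtr (ler0n R 2)) -exprMn !mulrA.
  by rewrite expr_le1 // ltW // mulr_gt0.
(* Optimality of [xstar] centers the gradients, as the variance formula requires. *)
have grad0 : \sum_i gradient (f i) xstar = 0.
  have := gradient_minimizer hL (differentiable_average hdiff) hsmooth hmin.
  rewrite gradient_average // => /eqP.
  by rewrite scaler_eq0 invr_eq0 gt_eqF //= => /eqP.
pose a i := gradient (f i) xstar.
pose h q := gamma ^+ 2 * L / (n%:R * T%:R) * tail_variance a q.
have h0 q : 0 <= h q.
  apply: mulr_ge0; last by apply: sumr_ge0 => k _; exact: dot_ge0.
  by rewrite divr_ge0 // mulr_ge0 ?sqr_ge0 // ltW.
pose c := dot (x0 - xstar) (x0 - xstar) / (2 * gamma * n%:R * T%:R).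
have c0 : 0 <= c by rewrite divr_ge0 ?dot_ge0 // !mulr_ge0 // ltW.
(* The suboptimality is nonnegative by [hmin], so the pathwise bound passes to expectations. *)
apply: (le_trans (y := ('E_P[fun w => (c + \sum_(t < T) h (p t w))%R])%E)).
  apply: ge0_le_expectation => w; first by rewrite subr_ge0.
  exact: average_iterate_le.
rewrite (expectation_const_add_sum unif h0 c0) lee_fin enorm_sqr lerD2l.
have := sum_tail_variance_le grad0.
have N0 : 0 < #|{perm 'I_n}|%:R :> R.
  by rewrite ltr0n; apply/card_gt0P; exists 1%g.
have -> : \sum_i enorm (gradient (f i) xstar) ^+ 2 = \sum_i dot (a i) (a i).
  by apply: eq_bigr => i _; rewrite enorm_sqr.
have -> : \sum_q h q =
    gamma ^+ 2 * L / (n%:R * T%:R) * \sum_q tail_variance a q.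
  by rewrite mulr_sumr.
move: N0; move: (_%:R : R) (\sum_q _) (\sum_i _) => N S V N0 VS.
(* Both sides are given the same nonnegative factor, which leaves exactly
   [4 * V <= N * n%:R * S]. *)
have -> : T%:R * (N^-1 * (gamma ^+ 2 * L / (n%:R * T%:R) * V)) =
    gamma ^+ 2 * L / (4 * n%:R * N) * (4 * V).
  by field; rewrite !gt_eqF.
have -> : gamma ^+ 2 * L * n%:R * (n%:R^-1 * S) / 4 =
    gamma ^+ 2 * L / (4 * n%:R * N) * (N * n%:R * S).
  by field; rewrite !gt_eqF.
by rewrite ler_wpM2l // divr_ge0 // ?mulr_ge0 ?ltW.
Qed.
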